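(* Let $n,p,q$ be positive integers with $p\le n$, $q\le n$, and $\delta\in[0,1]$. If a distribution over permutations of $[n]$ satisfies the $(p,q,\delta)$-block-independence property, then it satisfies the $\bigl(p,\delta+\frac{p^2}{q}\bigr)$-uniform-induced-ordering property.
   Context: A permutation $\pi$ of $[n]$ is interpreted as an arrival order, $\pi(i)$ being the position of item $i$. $(k,\delta)$-uniform-induced-ordering property: for every $k$ distinct items $x_1,\dots,x_k\in[n]$, $\Pr[\pi(x_1)<\pi(x_2)<\dots<\pi(x_k)]\ge(1-\delta)\frac{1}{k!}$. $(p,q,\delta)$-block-independence property: partition $[n]$ into $q$ consecutive disjoint blocks $B_1,\dots,B_q$ (in increasing order), each of size between $\lfloor n/q\rfloor$ and $\lceil n/q\rceil$; require that for any distinct $x_1,\dots,x_p\in[n]$ and any $b_1,\dots,b_p\in[q]$ (not necessarily distinct), $\Pr[\pi(x_i)\in B_{b_i}\ \forall i]\ge(1-\delta)q^{-p}$. *)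

(* Defs.v *)
From mathcomp Require Export all_boot all_order all_algebra perm.

Set Implicit Arguments.
Unset Strict Implicit.
Unset Printing Implicit Defensive.

Import Order.TTheory GRing.Theory Num.Theory.

Local Open Scope ring_scope.

(* Items and positions are both numbered from 0, i.e. [n] is 'I_n; for
   s : 'S_n, s i is the arrival position of item i. *)

Definition is_distribution (R : realFieldType) (n : nat) (P : 'S_n -> R) : Prop :=
  (forall s, 0 <= P s) /\ \sum_(s : 'S_n) P s = 1.

Definition Pr (R : realFieldType) (n : nat) (P : 'S_n -> R) (E : pred 'S_n) : R :=
  \sum_(s : 'S_n | E s) P s.

Definition uniform_induced_ordering (R : realFieldType) (n k : nat) (delta : R)
    (P : 'S_n -> R) : Prop :=
  forall x : k.-tuple 'I_n, uniq x ->
    (1 - delta) * (1 / k`!%:R) <=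
      Pr P (fun s => sorted ltn [seq nat_of_ord (s y) | y <- x]).

Definition ceil_div (n q : nat) : nat := (n %/ q + ~~ (q %| n)%N)%N.

(* Blocks covering 'I_n and ordered by their index are automatically sets of
   consecutive positions. *)
Definition consecutive_blocks (n q : nat) (B : 'I_q -> {set 'I_n}) : Prop :=
  [/\ \bigcup_(b < q) B b = [set: 'I_n],
      (forall b c : 'I_q, b != c -> [disjoint B b & B c]),
      (forall b c : 'I_q, (b < c)%N ->
         forall i j : 'I_n, i \in B b -> j \in B c -> (i < j)%N)
    & (forall b : 'I_q, (n %/ q <= #|B b| <= ceil_div n q)%N)].

(* The property refers to one chosen partition into blocks; as it is used as a
   hypothesis, the existential covers every admissible choice. *)
Definition block_independence (R : realFieldType) (n p q : nat) (delta : R)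
    (P : 'S_n -> R) : Prop :=
  exists B : 'I_q -> {set 'I_n},
    consecutive_blocks B /\
    forall (x : p.-tuple 'I_n) (b : p.-tuple 'I_q), uniq x ->
      (1 - delta) * q%:R ^- p <=
        Pr P (fun s => [forall i : 'I_p, s (tnth x i) \in B (tnth b i)]).

(* Main.v *)
(** For strictly increasing block indices [b_1 < ... < b_p] the events
    "[x_i] arrives in block [b_i] for all [i]" are pairwise disjoint and each
    forces [x_1, ..., x_p] to arrive in order.  There are ['C(q, p)] of them, so
    the order has probability at least [(1 - delta) * 'C(q, p) / q ^ p], and
    [q ^_ p >= q ^ p * (1 - p ^ 2 / q)]. *)
Require Import Defs.
From mathcomp Require Import zify ring.

Set Implicit Arguments.
Unset Strict Implicit.
Unset Printing Implicit Defensive.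

Import Order.TTheory GRing.Theory Num.Theory.
Local Open Scope ring_scope.

Lemma ffact_le_expn (q p : nat) : (q ^_ p <= q ^ p)%N.
Proof.
elim: p => [|p IHp]; first by rewrite ffactn0 expn0.
by rewrite ffactnSr expnSr leq_mul // leq_subr.
Qed.

(** The estimate is multiplied by [q] so that it stays within [nat]. The induction closes because
    one more factor raises the loss coefficient from [p ^ 2] to at most [p ^ 2 + p <= p.+1 ^ 2]. *)
Lemma expn_le_ffact (q p : nat) :
  (q ^ p.+1 <= q * q ^_ p + p ^ 2 * q ^ p)%N.
Proof.
elim: p => [|p IHp]; first by rewrite ffactn0 expn1 muln1 leq_addr.
have leF := ffact_le_expn q p.
(* The new factor is the truncated [q - p]; replacing it by [q] costs at most [q ^_ p * p], also
   when [q < p]. *)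
have leD : (q ^_ p * q <= q ^_ p.+1 + q ^ p * p)%N.
  by rewrite ffactnSr; nia.
rewrite expnSr (leq_trans (leq_mul IHp (leqnn q))) //.
have := leq_mul (leqnn q) leD; rewrite expnSr !mulnDr !expnS !expn0; nia.
Qed.

Lemma ffact_div_expn_ge (R : realFieldType) (q p : nat) : (0 < q)%N ->
  1 - p%:R ^+ 2 / q%:R <= (q ^_ p)%:R * q%:R ^- p :> R.
Proof.
move=> q_gt0; have qR_gt0 : 0 < q%:R :> R by rewrite ltr0n.
have := expn_le_ffact q p.
rewrite -(ler_nat R) natrD !natrM !natrX => le_q.
rewrite lerBlDr -(ler_pM2l (exprn_gt0 p.+1 qR_gt0)) mulr1 (le_trans le_q) //.
rewrite le_eqVlt exprS; apply/orP; left; apply/eqP; field.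
by rewrite expf_neq0 lt0r_neq0.
Qed.

Section OrderedBlocks.

Variables (R : realFieldType) (n p q : nat) (P : 'S_n -> R).
Variable B : 'I_q -> {set 'I_n}.
Hypothesis P_ge0 : forall s, 0 <= P s.
Hypothesis disjB : forall b c : 'I_q, b != c -> [disjoint B b & B c].
Hypothesis ltB : forall b c : 'I_q, (b < c)%N ->
  forall i j : 'I_n, i \in B b -> j \in B c -> (i < j)%N.

Definition in_blocks (x : p.-tuple 'I_n) (b : p.-tuple 'I_q) (s : 'S_n) :=
  [forall i : 'I_p, s (tnth x i) \in B (tnth b i)].

Lemma in_blocks_inj (x : p.-tuple 'I_n) (b c : p.-tuple 'I_q) (s : 'S_n) :
  in_blocks x b s -> in_blocks x c s -> b = c.
Proof.
move=> /forallP xb /forallP xc; apply: eq_from_tnth => i.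
apply/eqP/negPn/negP => /disjB /disjointFr /(_ (xb i)).
by rewrite xc.
Qed.

Lemma in_blocks_sorted (x : p.-tuple 'I_n) (b : p.-tuple 'I_q) (s : 'S_n) :
  sorted ltn (map val b) -> in_blocks x b s ->
  sorted ltn [seq nat_of_ord (s y) | y <- x].
Proof.
move=> /(sortedP 0%N) sb /forallP xb; apply/(sortedP 0%N) => i.
rewrite size_map size_tuple => ltip.
have lti : (i < p)%N by apply: ltnW.
have := sb i; rewrite size_map size_tuple => /(_ ltip).
have nthE (T : Type) (f : T -> nat) (t : p.-tuple T) j (ltj : (j < p)%N) :
    nth 0%N (map f t) j = f (tnth t (Ordinal ltj)).
  (* [T] comes without an inhabitant, so an entry of [t] serves as the default value for [nth]. *)
  have y := tnth t (Ordinal ltj).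
  by rewrite (nth_map y) ?size_tuple // (tnth_nth y).
rewrite !(nthE _ _ _ _ lti, nthE _ _ _ _ ltip) => /ltB; exact.
Qed.

(** After exchanging the sums, each [s] contributes [P s] at most once, since its positions
    determine [b], and only when [s] puts [x] in order. *)
Lemma sum_Pr_in_blocks_le (x : p.-tuple 'I_n) :
  \sum_(b : p.-tuple 'I_q | sorted ltn (map val b)) Pr P (in_blocks x b) <=
    Pr P (fun s => sorted ltn [seq nat_of_ord (s y) | y <- x]).
Proof.
rewrite /Pr (exchange_big_dep
    (fun s : 'S_n => sorted ltn [seq nat_of_ord (s y) | y <- x])) /=.
  apply: ler_sum => s _.
  case: (pickP (fun b : p.-tuple 'I_q =>
      sorted ltn (map val b) && in_blocks x b s)) => [b /andP[sb xb]|no_b].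
    rewrite (big_pred1 b) // => c /=.
    apply/andP/eqP => [[_ xc]|->] //; exact: in_blocks_inj xc xb.
  by rewrite big_pred0.
move=> b s; exact: in_blocks_sorted.
Qed.

End OrderedBlocks.

Theorem mainTheorem3 (R : realFieldType) (n p q : nat) (delta : R)
  (hn : (0 < n)%N) (hp : (0 < p)%N) (hq : (0 < q)%N)
  (hpn : (p <= n)%N) (hqn : (q <= n)%N)
  (hdelta0 : 0 <= delta) (hdelta1 : delta <= 1)
  (P : 'S_n -> R) (hP : is_distribution P) :
  block_independence p q delta P ->
  uniform_induced_ordering p (delta + p%:R ^+ 2 / q%:R) P.
Proof.
case: hP => P_ge0 _ [B [[_ disjB ltB _] indep]] x x_uniq.
apply: le_trans (sum_Pr_in_blocks_le P_ge0 disjB ltB x).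
apply: le_trans (ler_sum _ (fun b _ => indep x b x_uniq)).
rewrite sumr_const -cardsE card_ltn_sorted_tuples -[leRHS]mulr_natl.
have pfact_gt0 : 0 < p`!%:R :> R by rewrite ltr0n fact_gt0.
(* Moving [p!] to the right turns the number of increasing tuples, ['C(q, p)], into [q ^_ p]. *)
rewrite mul1r ler_pdivrMr // [leRHS]mulrAC -natrM bin_ffact.
have := ffact_div_expn_ge R p hq.
set e := _ / _ => le_e.
have e_ge0 : 0 <= e by rewrite divr_ge0 ?exprn_ge0 ?ler0n.
(* It remains to see that [1 - (delta + e) <= (1 - delta) * (1 - e)], where the two sides differ by
   [delta * e]. *)
rewrite mulrCA; apply: le_trans (ler_wpM2l _ le_e); last by rewrite subr_ge0.
by rewrite mulrBr mulr1 opprD addrA lerD2l lerN2 ler_piMl // gerBl.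
Qed.
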